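(* For all integers $n > 1$, $$o1(n) + o1(n-1) = c(n),$$ where $o1(m)$ denotes the number of partitions of $m$ in which no odd part is repeated and the largest part is even, and $c(m)$ denotes the number of partitions of $m$ in which no part is congruent to $2$ modulo $4$.
   Context: A partition of a non-negative integer $m$ is a non-increasing sequence of positive integers $\lambda_1 \ge \lambda_2 \ge \cdots \ge \lambda_k$ (the parts) with $\sum_{i=1}^k \lambda_i = m$. Let $\text{O1}(m)$ be the set of partitions of $m$ in which every odd part occurs at most once (even parts may be repeated) and the largest part is even; $o1(m) = |\text{O1}(m)|$. Let $\text{C}(m)$ be the set of partitions of $m$ having no part congruent to $2$ modulo $4$; $c(m) = |\text{C}(m)|$. *)

(* Defs.v *)
From HB Require Import structures.
From mathcomp Require Import all_boot.

Set Implicit Arguments.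
Unset Strict Implicit.
Unset Printing Implicit Defensive.

Definition is_intpart (m : nat) (s : seq nat) : bool :=
  [&& sorted geq s, all (leq 1) s & sumn s == m].

Record intpart (m : nat) : Type :=
  IntPart { parts :> seq nat; intpartP : is_intpart m parts }.

HB.instance Definition _ (m : nat) := [isSub for @parts m].
HB.instance Definition _ (m : nat) := [Countable of intpart m by <:].

(* Finiteness: a partition of m has at most m parts, each at most m, so it
   embeds into the finite type of bounded sequences over 'I_m.+1. *)

Lemma intpart_size_le (m : nat) (p : intpart m) : size p <= m.
Proof.
case: p => s /= /and3P[_ s_gt0 /eqP <-].
by elim: s s_gt0 => //= x s IHs /andP[x_gt0 /IHs]; rewrite -add1n; apply: leq_add.
Qed.

Lemma intpart_part_le (m : nat) (p : intpart m) (i : nat) : i \in parts p -> i <= m.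
Proof.
case: p => s /= /and3P[_ _ /eqP <-]; elim: s => //= x s IHs.
rewrite inE => /orP[/eqP-> | /IHs le_i]; first exact: leq_addr.
exact: leq_trans le_i (leq_addl _ _).
Qed.

Lemma intpart_bseq_subproof (m : nat) (p : intpart m) :
  size [seq (inord i : 'I_m.+1) | i <- parts p] <= m.
Proof. by rewrite size_map intpart_size_le. Qed.

Definition bseq_of_intpart (m : nat) (p : intpart m) : m.-bseq 'I_m.+1 :=
  Bseq (intpart_bseq_subproof p).

Definition intpart_of_bseq (m : nat) (b : m.-bseq 'I_m.+1) : option (intpart m) :=
  insub [seq val i | i <- b].

Lemma bseq_of_intpartK (m : nat) :
  pcancel (@bseq_of_intpart m) (@intpart_of_bseq m).
Proof.
move=> p; rewrite /intpart_of_bseq /= -map_comp.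
rewrite map_id_in; first exact: (valK p).
by move=> i /intpart_part_le le_i; rewrite /= inordK.
Qed.

HB.instance Definition _ (m : nat) : isFinite (intpart m) :=
  PCanIsFinite (@bseq_of_intpartK m).

(* The parts are listed in non-increasing order, so the head is the largest
   part; the default value 0 only matters for the empty partition (m = 0). *)
Definition largest_part (m : nat) (p : intpart m) : nat := head 0 p.

Definition O1 (m : nat) : {set intpart m} :=
  [set p : intpart m |
     all (fun i => odd i ==> (count_mem i p <= 1)) p
     && ~~ odd (largest_part p)].

Definition o1 (m : nat) : nat := #|O1 m|.

Definition C (m : nat) : {set intpart m} :=
  [set p : intpart m | all (fun i => i != 2 %[mod 4]) p].

Definition c (m : nat) : nat := #|C m|.

(* Main.v *)
Require Import Defs.
From mathcomp Require Import all_boot.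
From mathcomp Require Import zify.

Set Implicit Arguments.
Unset Strict Implicit.
Unset Printing Implicit Defensive.

(** Both sides count the partitions of [n] without repeated odd part.
    Splitting every part [4k+2] into two copies of [2k+1] is a bijection from
    these onto the partitions without part congruent to 2 modulo 4: in the
    inverse direction, equal odd parts are merged in pairs. On the other hand,
    if the largest part is odd, it occurs once, so that decreasing it by 1 gives
    a partition of [n-1] of the same kind whose largest part is even. *)

(** The condition that [O1] puts on odd parts, taken on plain sequences so that it also applies to
    unsorted ones. *)
Definition odd_simple (s : seq nat) : bool :=
  all (fun i => odd i ==> (count_mem i s <= 1)) s.

Lemma odd_simpleP (s : seq nat) :
  reflect (forall i, odd i -> count_mem i s <= 1) (odd_simple s).
Proof.
apply: (iffP allP) => [simple_s i odd_i | simple_s i _]; last first.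
  exact/implyP/simple_s.
have [/simple_s/implyP-> // | /count_memPn-> //] := boolP (i \in s).
Qed.

Lemma perm_odd_simple (s t : seq nat) :
  perm_eq s t -> odd_simple s = odd_simple t.
Proof.
move=> /permP eq_st.
by apply/odd_simpleP/odd_simpleP => simple i /simple; rewrite eq_st.
Qed.

Lemma odd_simple_cons (x : nat) (s : seq nat) :
  odd_simple (x :: s) = (odd x ==> (x \notin s)) && odd_simple s.
Proof.
apply/odd_simpleP/andP => [simple | [x_s /odd_simpleP simple] i odd_i] /=.
  split; last by apply/odd_simpleP => i /simple; apply: leq_trans (leq_addl _ _).
  apply/implyP => /simple /=; rewrite eqxx; apply: contraL.
  by rewrite -has_pred1 has_count -ltnNge.
have := simple i odd_i; case: eqP => [x_i | _] //=; rewrite -x_i in odd_i *.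
by rewrite (count_memPn _) //; apply: implyP x_s _.
Qed.

Lemma geq_sorted_head_ge {x : nat} {s : seq nat} :
  sorted geq (x :: s) -> forall y, y \in s -> y <= x.
Proof.
by move=> /= /(order_path_min (fun _ _ _ h1 h2 => leq_trans h2 h1))/allP.
Qed.

(** A non-increasing sequence is determined by its multiset of elements. Hence splitting and merging
    can be studied on unsorted sequences up to [perm_eq]. *)
Lemma perm_intpart_eq (m : nat) (p q : intpart m) : perm_eq p q -> p = q.
Proof.
move=> eq_pq; apply/val_inj; move: (intpartP p) (intpartP q).
move=> /and3P[p_sorted _ _] /and3P[q_sorted _ _] /=.
apply: (sorted_eq (leT := geq)) => // [y x z | x y]; rewrite /geq /=; lia.
Qed.

Lemma is_intpart_sort (m : nat) (s : seq nat) :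
  all (leq 1) s -> sumn s = m -> is_intpart m (sort geq s).
Proof.
move=> s_gt0 <-; rewrite /is_intpart all_sort s_gt0 /=.
rewrite (perm_sumn (_ : perm_eq _ s)) ?perm_sort // eqxx andbT.
by apply: sort_sorted => x y; apply: leq_total.
Qed.

Definition split_part (x : nat) : seq nat :=
  if x %% 4 == 2 then [:: x./2; x./2] else [:: x].

Definition split_parts (s : seq nat) : seq nat := flatten (map split_part s).

Lemma split_parts_cons (x : nat) (s : seq nat) :
  split_parts (x :: s) = split_part x ++ split_parts s.
Proof. by []. Qed.

Lemma split_parts_gt0 (s : seq nat) :
  all (leq 1) s -> all (leq 1) (split_parts s).
Proof.
elim: s => //= x s IHs /andP[x_gt0 /IHs s_gt0].
rewrite split_parts_cons all_cat s_gt0 andbT /split_part.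
by case: eqP => /= x_mod; lia.
Qed.

Lemma sumn_split_parts (s : seq nat) : sumn (split_parts s) = sumn s.
Proof.
elim: s => //= x s IHs; rewrite split_parts_cons sumn_cat IHs /split_part.
by case: eqP => /= x_mod; lia.
Qed.

Lemma split_parts_mod4 (s : seq nat) :
  all (fun i => i != 2 %[mod 4]) (split_parts s).
Proof.
elim: s => // x s IHs; rewrite split_parts_cons all_cat IHs andbT /split_part.
by case: eqP => /= x_mod; lia.
Qed.

Lemma perm_split_parts (s t : seq nat) :
  perm_eq s t -> perm_eq (split_parts s) (split_parts t).
Proof. by move=> eq_st; apply/perm_flatten/perm_map. Qed.

(** An odd [k] comes from the parts [k], once each, and from the parts [k.*2], which are 2 modulo 4,
    twice each; an even [k] can only come from itself. *)
Lemma count_split_parts (k : nat) (s : seq nat) :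
  count_mem k (split_parts s) =
    if odd k then count_mem k s + (count_mem k.*2 s).*2
    else if k %% 4 == 2 then 0 else count_mem k s.
Proof.
elim: s => [|x s IHs]; first by do !case: ifP.
rewrite split_parts_cons count_cat IHs /split_part /=.
case: (x %% 4 =P 2) => x_mod /=; case: (boolP (odd k)) => k_odd;
  case: (k %% 4 =P 2) => k_mod;
  do ?[case: eqP => ?] => /=; lia.
Qed.

(** For odd [k] the multiplicity of [k] is 0 or 1, so in [count_split_parts] it is the remainder
    modulo 2, and that of [k.*2] is the quotient. *)
Lemma split_parts_inj (s t : seq nat) :
  odd_simple s -> odd_simple t ->
  perm_eq (split_parts s) (split_parts t) -> perm_eq s t.
Proof.
move=> /odd_simpleP simple_s /odd_simpleP simple_t /permP eq_st.
have count_eq k := etrans (esym (count_split_parts k s))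
                     (etrans (eq_st (pred1 k)) (count_split_parts k t)).
have odd_eq k : odd k ->
    count_mem k s = count_mem k t /\ count_mem k.*2 s = count_mem k.*2 t.
  move=> k_odd; move: (count_eq k) (simple_s k k_odd) (simple_t k k_odd).
  rewrite k_odd; move: (count_mem k s) (count_mem k.*2 s).
  by move: (count_mem k t) (count_mem k.*2 t); lia.
apply/allP => k _ /=; apply/eqP; case: (boolP (odd k)) => [/odd_eq[] // | k_even].
have := count_eq k; rewrite (negPf k_even); case: eqP => // k_mod _.
(* The parts 2 modulo 4 are the doubles of odd numbers, so [odd_eq] covers them. *)
have half_odd : odd k./2 by lia.
by have [_] := odd_eq _ half_odd; rewrite even_halfK.
Qed.

(** A preimage is built greedily, one part [x] of [t] at a time: an odd [x] already present is
    merged with its copy into the even part [x.*2], and any other [x] is simply added. *)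
Lemma split_parts_surj (t : seq nat) :
  all (leq 1) t -> all (fun i => i != 2 %[mod 4]) t ->
  exists s, [/\ all (leq 1) s, odd_simple s & perm_eq (split_parts s) t].
Proof.
elim: t => [|x t IHt] /=; first by exists [::].
move=> /andP[x_gt0 t_gt0] /andP[x_mod t_mod].
have [s [s_gt0 simple_s eq_st]] := IHt t_gt0 t_mod.
have [/andP[x_odd x_s] | x_new] := boolP (odd x && (x \in s)); last first.
  exists (x :: s); split; first by rewrite /= x_gt0.
    by rewrite odd_simple_cons simple_s andbT implybE -negb_and.
  by rewrite split_parts_cons /split_part (negPf x_mod) /= perm_cons.
have eq_s := perm_to_rem x_s.
move: s_gt0; rewrite (perm_all _ eq_s) /= => /andP[_ rem_gt0].
move: simple_s; rewrite (perm_odd_simple eq_s) odd_simple_cons => /andP[_ simple_rem].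
exists (x.*2 :: rem x s); split; first by rewrite /= rem_gt0 andbT; lia.
  by rewrite odd_simple_cons odd_double.
rewrite split_parts_cons /split_part ifT /=; last by lia.
rewrite doubleK perm_cons; apply: perm_trans eq_st.
rewrite perm_sym; apply: perm_trans (perm_split_parts eq_s) _.
by rewrite split_parts_cons /split_part (negPf x_mod).
Qed.

Lemma split_intpart_subproof (m : nat) (p : intpart m) :
  is_intpart m (sort geq (split_parts p)).
Proof.
have /and3P[_ p_gt0 /eqP sum_p] := intpartP p.
by apply: is_intpart_sort; rewrite ?split_parts_gt0 ?sumn_split_parts.
Qed.

Definition split_intpart (m : nat) (p : intpart m) : intpart m :=
  IntPart (split_intpart_subproof p).

Lemma card_odd_simple (m : nat) : #|[set p : intpart m | odd_simple p]| = c m.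
Proof.
have split_inj : {in [set p : intpart m | odd_simple p] &,
                  injective (@split_intpart m)}.
  move=> p q; rewrite !inE => simple_p simple_q /(congr1 (@parts m))/= eq_pq.
  apply/perm_intpart_eq/split_parts_inj => //.
  by rewrite -(perm_sort geq) eq_pq perm_sort.
rewrite -(card_in_imset split_inj); apply: eq_card => q; rewrite inE.
apply/imsetP/idP => [[p _ ->] | q_mod] /=.
  by rewrite all_sort split_parts_mod4.
have /and3P[_ q_gt0 /eqP sum_q] := intpartP q.
have [s [s_gt0 simple_s eq_sq]] := split_parts_surj q_gt0 q_mod.
have sum_s : sumn s = m by rewrite -sumn_split_parts (perm_sumn eq_sq).
have perm_s : perm_eq (sort geq s) s by rewrite perm_sort.
exists (IntPart (is_intpart_sort s_gt0 sum_s)).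
  by rewrite inE (perm_odd_simple perm_s).
apply: perm_intpart_eq => /=; rewrite perm_sym perm_sort.
exact: perm_trans (perm_split_parts perm_s) eq_sq.
Qed.

(* The value [1] on the empty sequence only serves to make [incr_intpart]
   total. *)
Definition incr_head (s : seq nat) : seq nat :=
  if s is x :: s' then x.+1 :: s' else [:: 1].

Lemma incr_intpart_subproof (m : nat) (p : intpart m) :
  is_intpart m.+1 (incr_head p).
Proof.
case: p => [[|x s]] /and3P[/= s_sorted s_gt0 /eqP <-] //.
rewrite /is_intpart /= addSn eqxx andbT; apply/andP; split.
  by case: s s_sorted {s_gt0} => //= y s /andP[xy ->]; rewrite andbT /geq /= ltnW.
by case/andP: s_gt0.
Qed.

Definition incr_intpart (m : nat) (p : intpart m) : intpart m.+1 :=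
  IntPart (incr_intpart_subproof p).

Lemma card_odd_simple_odd_largest (m : nat) : 0 < m ->
  #|[set p : intpart m.+1 | odd_simple p & odd (largest_part p)]| = o1 m.
Proof.
move=> m_gt0; have nil_part : ~ is_intpart m [::] by case: m m_gt0.
have incr_inj : injective (@incr_intpart m).
  case=> [[|x s] p_s] [[|y t] p_t] /(congr1 (@parts _))/= eq_st; apply/val_inj => //=.
  by case: eq_st => -> ->.
rewrite /o1 -(card_imset _ incr_inj); apply: eq_card => q; rewrite inE.
apply/andP/imsetP => [[simple_q odd_q] | [[[|x s] p_s] + ->]]; last 2 first.
- by case: nil_part.
- rewrite inE => /andP[simple_s even_x].
  have {}simple_s : odd_simple (x :: s) := simple_s.
  have [/geq_sorted_head_ge le_x _ _] := and3P p_s.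
  change (odd_simple (x.+1 :: s) /\ odd x.+1).
  (* All parts in [s] are at most [x], so the odd head [x.+1] is not repeated. *)
  move: simple_s; rewrite !odd_simple_cons => /andP[_ ->].
  split=> //; rewrite andbT; apply/implyP => _.
  by apply/negP => /le_x; rewrite ltnn.
case: q simple_q odd_q => [[|x s] p_s] //=; rewrite /largest_part /= => simple_s odd_x.
have [s_sorted s_gt0 /eqP sum_s] := and3P p_s.
case: x => // x in p_s simple_s odd_x s_sorted s_gt0 sum_s *.
move: simple_s; rewrite odd_simple_cons odd_x => /andP[/= x_s simple_s].
(* The odd head [x.+1] is not repeated, so the other parts are strictly smaller and lowering the
   head keeps the order. *)
have le_x y : y \in s -> y <= x.
  move=> y_s; have := geq_sorted_head_ge s_sorted y_s.
  by rewrite leq_eqVlt => /predU1P[eq_y | //]; rewrite -eq_y y_s in x_s.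
(* If [x] were 0, all other parts would be at most 0, leaving the single part 1, whose sum is less
   than [m.+1]. *)
have x_gt0 : 0 < x.
  case: x {p_s odd_x s_sorted} => // in x_s s_gt0 sum_s le_x *.
  case: s {x_s simple_s} => [|y s] in s_gt0 sum_s le_x *; first by move: sum_s => /=; lia.
  by have := le_x y (mem_head _ _); move: s_gt0 => /= /andP[]; lia.
have p_q : is_intpart m (x :: s).
  apply/and3P; split; last by apply/eqP; move: sum_s => /=; lia.
    case: s s_sorted le_x {p_s s_gt0 sum_s x_s simple_s} => //= y s /andP[_ ->] le_x.
    by rewrite andbT; apply: le_x (mem_head _ _).
  by move: s_gt0 => /=; rewrite x_gt0.
exists (IntPart p_q); last exact: val_inj.
rewrite inE -/(odd_simple (x :: s)) odd_simple_cons simple_s /largest_part /=.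
by move: odd_x => /= /negPf->.
Qed.

Theorem theorem3p1 (n : nat) (n_gt1 : 1 < n) : o1 n + o1 (n - 1) = c n.
Proof.
case: n n_gt1 => // m m_gt0; rewrite subn1 /= -card_odd_simple.
rewrite -(card_odd_simple_odd_largest m_gt0) {1}/o1.
(* The partitions without repeated odd part are sorted by the parity of the largest part; the even
   case is [O1 m.+1]. *)
rewrite -[RHS](cardsID [set p : intpart m.+1 | odd (largest_part p)]) addnC.
congr (_ + _); apply: eq_card => p; rewrite !inE //.
by rewrite andbC.
Qed.
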